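(* Let $f, c, \kappa_1, \kappa_2, k, j \geq 1$ be integers, and let $W^\ell \in \mathbb{R}^{f \times c\kappa_1\kappa_2}$ be a nonzero layer matrix, partitioned by channel slicing into $k$ consecutive column blocks $W^\ell = [W^\ell_1 \cdots W^\ell_k]$ with $W^\ell_i \in \mathbb{R}^{f \times c_i\kappa_1\kappa_2}$ and $\sum_{i=1}^k c_i = c$. Let $\hat{W}^\ell = [\hat{W}^\ell_1 \cdots \hat{W}^\ell_k]$ be the corresponding low-rank approximation, where for each $i \in [k]$ the matrix $\hat{W}^\ell_i$ is the rank-$j$ approximation of $W^\ell_i$ obtained by truncating its singular value decomposition. Then the relative error $\varepsilon^\ell := \|\hat{W}^\ell - W^\ell\| / \|W^\ell\|$ satisfies $$\varepsilon^\ell \leq \frac{\sqrt{k}}{\alpha_1} \cdot \max_{i \in [k]} \alpha_{i,j+1},$$ where $\alpha_{i,j+1}$ is the $(j+1)$-th largest singular value of $W^\ell_i$ for every $i \in [k]$, and $\alpha_1 = \|W^\ell\|$ is the largest singular value of $W^\ell$.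
   Context: Here $[k] = \{1, \ldots, k\}$ and $\|\cdot\|$ denotes the operator (spectral) norm of a real matrix, i.e. its largest singular value. The superscript $\ell$ is only an index (of a layer in a neural network). The matrix $W^\ell \in \mathbb{R}^{f \times c\kappa_1\kappa_2}$ is the matrix obtained by flattening the weight tensor (of shape $f \times c \times \kappa_1 \times \kappa_2$) of a convolutional layer with $f$ filters, $c$ input channels and a $\kappa_1 \times \kappa_2$ kernel: each filter becomes a row, and each channel corresponds to $\kappa_1\kappa_2$ consecutive columns. Channel slicing: the $c$ channels are divided into $k$ subsets of consecutive channels, the $i$-th subset having $c_i \leq \lceil c/k \rceil$ channels, with $\sum_{i=1}^k c_i = c$. The block $W^\ell_i \in \mathbb{R}^{f \times c_i\kappa_1\kappa_2}$ consists of the columns of $W^\ell$ belonging to the $i$-th subset, so that $W^\ell = [W^\ell_1 \cdots W^\ell_k]$ (horizontal concatenation). Rank-$j$ approximation: if $W^\ell_i = \tilde{U}_i \tilde{\Sigma}_i \tilde{V}_i$ is a singular value decomposition ($\tilde{U}_i$ and $\tilde{V}_i$ orthogonal square matrices, $\tilde{\Sigma}_i$ rectangular diagonal with nonnegative, nonincreasing diagonal entries), then $\hat{W}^\ell_i = \tilde{U}_i \hat{\Sigma}_i \tilde{V}_i$, where $\hat{\Sigma}_i$ has the same first $j$ diagonal entries as $\tilde{\Sigma}_i$ and all other entries zero. (Equivalently, $\hat{W}^\ell_i = U_i V_i$ with $U_i$ having $j$ columns and $V_i$ having $j$ rows.) Singular values are listed in nonincreasing order with multiplicity; a singular value whose index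 exceeds the smaller dimension of the matrix is taken to be $0$. *)

(* Defs.v *)
(* MathComp world; the real numbers are an arbitrary [R : realType]. *)
From HB Require Import structures.
From mathcomp Require Import all_boot all_order all_algebra.
From mathcomp Require Import polyrcf.
From mathcomp Require Import classical_sets reals.

Set Implicit Arguments.
Unset Strict Implicit.
Unset Printing Implicit Defensive.

Import Order.TTheory GRing.Theory Num.Theory.
Local Open Scope ring_scope.
Local Open Scope classical_set_scope.

Definition l2norm (R : realType) (n : nat) (x : 'cV[R]_n) : R :=
  Num.sqrt (\sum_i x i 0 ^+ 2).

Definition opnorm (R : realType) (m n : nat) (A : 'M[R]_(m, n)) : R :=
  sup [set l2norm (A *m x) | x in [set x : 'cV[R]_n | l2norm x <= 1]].

(* The square roots of the eigenvalues of A^T A, each eigenvalue being repeated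
   according to its multiplicity as a root of the characteristic polynomial,
   in nonincreasing order. When m < n the list is the usual one extended by
   n - m zeros. *)
Definition singular_values (R : realType) (m n : nat) (A : 'M[R]_(m, n)) :
    seq R :=
  let p := char_poly (A^T *m A) in
  sort >=%R (flatten [seq nseq (mup x p) (Num.sqrt x) | x <- rootsR p]).

(* The p-th largest singular value, with p counted from 1; it is 0 when p
   exceeds the smaller dimension of A. *)
Definition singular_value (R : realType) (m n : nat) (A : 'M[R]_(m, n))
    (p : nat) : R :=
  (singular_values A)`_p.-1.

Definition orthogonal_mx (R : realType) (n : nat) (U : 'M[R]_n) : Prop :=
  U^T *m U = 1%:M /\ U *m U^T = 1%:M.

(* The right factor is V itself, not its transpose. *)
Definition is_svd (R : realType) (m n : nat) (A : 'M[R]_(m, n))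
    (U : 'M[R]_m) (S : 'M[R]_(m, n)) (V : 'M[R]_n) : Prop :=
  [/\ orthogonal_mx U, orthogonal_mx V, is_diag_mx S /\ A = U *m S *m V,
      (forall (a : 'I_m) (b : 'I_n), a = b :> nat -> 0 <= S a b)
    & (forall (a a' : 'I_m) (b b' : 'I_n), a = b :> nat -> a' = b' :> nat ->
         (a <= a')%N -> S a' b' <= S a b)].

Definition diag_truncate (R : realType) (j m n : nat) (S : 'M[R]_(m, n)) :
    'M[R]_(m, n) :=
  \matrix_(a, b) (if ((a == b :> nat) && (a < j))%N then S a b else 0).

(* A predicate rather than a function, since the truncation depends on the
   decomposition that is chosen when the j-th and (j+1)-st singular values
   coincide. *)
Definition is_rank_approx (R : realType) (j m n : nat)
    (A A_hat : 'M[R]_(m, n)) : Prop :=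
  exists U S V, is_svd A U S V /\ A_hat = U *m diag_truncate j S *m V.

Lemma slicing_width (c kappa1 kappa2 k : nat) (cs : 'I_k -> nat) :
  (\sum_(i < k) cs i = c)%N ->
  (\sum_(i < k) cs i * kappa1 * kappa2 = c * kappa1 * kappa2)%N.
Proof. by move=> <-; rewrite -!big_distrl. Qed.

(* In an f x (c * kappa1 * kappa2) layer matrix, channel t occupies the columns
   t * kappa1 * kappa2, ..., (t + 1) * kappa1 * kappa2 - 1. The block i gathers
   the cs i channels that follow the channels of the blocks 0, ..., i - 1. *)
Definition channel_block (R : realType) (f c kappa1 kappa2 k : nat)
    (cs : 'I_k -> nat) (sum_cs : (\sum_(i < k) cs i = c)%N)
    (W : 'M[R]_(f, c * kappa1 * kappa2)) (i : 'I_k) :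
    'M[R]_(f, cs i * kappa1 * kappa2) :=
  submxrow (castmx (erefl f, esym (slicing_width kappa1 kappa2 sum_cs)) W) i.

Definition channel_concat (R : realType) (f c kappa1 kappa2 k : nat)
    (cs : 'I_k -> nat) (sum_cs : (\sum_(i < k) cs i = c)%N)
    (Ws : forall i : 'I_k, 'M[R]_(f, cs i * kappa1 * kappa2)) :
    'M[R]_(f, c * kappa1 * kappa2) :=
  castmx (erefl f, slicing_width kappa1 kappa2 sum_cs) (\mxrow_i Ws i).

(* Main.v *)
(* On [x = (x_1, ..., x_k)] the error acts as [sum_i E_i x_i], with
   [E_i = W_hat_i - W_i] of norm [alpha_(i,j+1)]; the factor [sqrt k] comes from
   [|sum_i v_i|^2 <= k sum_i |v_i|^2] and [sum_i |x_i|^2 = |x|^2]. *)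
Require Import Defs.
From HB Require Import structures.
From mathcomp Require Import all_boot all_order all_algebra.
From mathcomp Require Import polyrcf.
From mathcomp Require Import classical_sets reals.
From mathcomp Require Import ring lra.

Import Order.TTheory GRing.Theory Num.Theory.
Local Open Scope ring_scope.

(** * Squared Euclidean norm *)

(** The radicand of [l2norm]. Estimates are made on squares, where they are polynomial; square roots
    return only at the supremum in [opnorm]. *)
Definition sqnorm {R : realType} {n : nat} (x : 'cV[R]_n) : R :=
  \sum_i x i 0 ^+ 2.

Lemma sqnormE {R : realType} {n : nat} (x : 'cV[R]_n) :
  sqnorm x = (x^T *m x) 0 0.
Proof. by rewrite mxE; apply: eq_bigr => i _; rewrite mxE expr2. Qed.

Lemma sqnorm_ge0 {R : realType} {n : nat} (x : 'cV[R]_n) : 0 <= sqnorm x.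
Proof. by apply: sumr_ge0 => i _; apply: sqr_ge0. Qed.

Lemma sqnorm0 {R : realType} {n : nat} : sqnorm (0 : 'cV[R]_n) = 0.
Proof. by apply: big1 => i _; rewrite mxE expr0n. Qed.

Lemma sqnorm_eq0 {R : realType} {n : nat} (x : 'cV[R]_n) :
  sqnorm x = 0 -> x = 0.
Proof.
move=> /psumr_eq0P x0; apply/colP => i; rewrite mxE.
by apply/eqP; rewrite -sqrf_eq0; apply/eqP/x0 => // a _; apply: sqr_ge0.
Qed.

Lemma sqnormZ {R : realType} {n : nat} (a : R) (x : 'cV[R]_n) :
  sqnorm (a *: x) = a ^+ 2 * sqnorm x.
Proof. by rewrite mulr_sumr; apply: eq_bigr => i _; rewrite mxE exprMn. Qed.

Lemma sqr_l2norm {R : realType} {n : nat} (x : 'cV[R]_n) :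
  l2norm x ^+ 2 = sqnorm x.
Proof. by rewrite sqr_sqrtr // sqnorm_ge0. Qed.

Lemma sqnorm_mulmx {R : realType} {m n : nat} (A : 'M[R]_(m, n))
    (x : 'cV[R]_n) :
  sqnorm (A *m x) = (x^T *m (A^T *m A *m x)) 0 0.
Proof. by rewrite sqnormE trmx_mul !mulmxA. Qed.

Lemma sqnorm_orthogonal {R : realType} {n : nat} (U : 'M[R]_n)
    (x : 'cV[R]_n) :
  orthogonal_mx U -> sqnorm (U *m x) = sqnorm x.
Proof. by case=> UtU _; rewrite sqnorm_mulmx UtU mul1mx sqnormE. Qed.

(** Cauchy-Schwarz against the all-ones vector, read off from [0 <= \sum_i (N * a i - S) ^+ 2 = N *
    (N * Q - S ^+ 2)]. Cancelling [N] requires [n] positive, so the empty sum is treated apart. *)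
Lemma sqr_sum_le {R : realFieldType} {n : nat} (a : 'I_n -> R) :
  (\sum_i a i) ^+ 2 <= n%:R * \sum_i a i ^+ 2.
Proof.
case: n a => [|n] a; first by rewrite !big_ord0 expr0n mulr0.
set S := \sum_i a i; set Q := \sum_i a i ^+ 2; set N : R := n.+1%:R.
have N_gt0 : 0 < N by rewrite ltr0n.
have : 0 <= \sum_i (N * a i - S) ^+ 2.
  by apply: sumr_ge0 => i _; apply: sqr_ge0.
rewrite (eq_bigr (fun i => (N ^+ 2 * a i ^+ 2 - N * S *+ 2 * a i) + S ^+ 2));
  last by move=> i _; ring.
rewrite big_split big_split /= sumrN -!mulr_sumr sumr_const card_ord.
rewrite -[_ *+ n.+1]mulr_natl -/S -/Q -/N.
have -> : N ^+ 2 * Q - N * S *+ 2 * S + S * (N * S) = N * (N * Q - S ^+ 2).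
  by ring.
by rewrite pmulr_rge0 // subr_ge0.
Qed.

Lemma sqnorm_sum_le {R : realType} {m k : nat} (v : 'I_k -> 'cV[R]_m) :
  sqnorm (\sum_i v i) <= k%:R * \sum_i sqnorm (v i).
Proof.
rewrite exchange_big mulr_sumr; apply: ler_sum => a _ /=.
by rewrite summxE; apply: sqr_sum_le.
Qed.

(** * Operator norm and eigenvalues of the Gram matrix *)

(** A crude bound that makes the supremum in [opnorm] finite; applied to an inverse matrix, it also
    bounds vectors from below. *)
Lemma sqnorm_mulmx_bounded {R : realType} {m n : nat} (A : 'M[R]_(m, n)) :
  exists2 C : R, 0 < C & forall x, sqnorm (A *m x) <= C * sqnorm x.
Proof.
(* The summand [1] keeps the constant positive even for a zero matrix, so that it can be inverted
   later. *)
exists (1 + \sum_i (n%:R * \sum_b A i b ^+ 2)).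
  rewrite ltr_pwDl //; apply: sumr_ge0 => i _; apply: mulr_ge0 => //.
  by apply: sumr_ge0 => b _; apply: sqr_ge0.
move=> x; rewrite mulrDl mul1r mulr_suml -[leLHS]add0r lerD ?sqnorm_ge0 //.
apply: ler_sum => i _; rewrite mxE; apply: le_trans (sqr_sum_le _) _.
rewrite -mulrA ler_wpM2l // mulr_suml; apply: ler_sum => b _.
rewrite exprMn ler_wpM2l ?sqr_ge0 // /sqnorm (bigD1 b) //= lerDl.
by apply: sumr_ge0 => a _; apply: sqr_ge0.
Qed.

Lemma opnorm_le {R : realType} {m n : nat} (A : 'M[R]_(m, n)) (c : R) :
  0 <= c -> (forall x, sqnorm (A *m x) <= c ^+ 2 * sqnorm x) ->
  opnorm A <= c.
Proof.
move=> c_ge0 leAc; apply: ge_sup => [|_ [x /= x_le1 <-]].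
  by exists (l2norm (A *m 0)); exists 0 => //=; rewrite /l2norm -/(sqnorm _)
    sqnorm0 sqrtr0.
rewrite -[c]ger0_norm // -sqrtr_sqr; apply: ler_wsqrtr.
apply: le_trans (leAc x) _; rewrite -[leRHS]mulr1 ler_wpM2l ?sqr_ge0 //.
by rewrite -sqr_l2norm expr_le1 // sqrtr_ge0.
Qed.

Lemma l2norm_le_opnorm {R : realType} {m n : nat} (A : 'M[R]_(m, n))
    (x : 'cV[R]_n) :
  l2norm x <= 1 -> l2norm (A *m x) <= opnorm A.
Proof.
move=> x_le1; apply: ub_le_sup; last by exists x.
have [C C_gt0 leAC] := sqnorm_mulmx_bounded A.
exists (Num.sqrt C) => _ [y /= y_le1 <-]; apply: ler_wsqrtr.
apply: le_trans (leAC y) _; rewrite -[leRHS]mulr1 ler_wpM2l ?(ltW C_gt0) //.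
by rewrite -sqr_l2norm expr_le1 // sqrtr_ge0.
Qed.

Lemma opnorm_ge0 {R : realType} {m n : nat} (A : 'M[R]_(m, n)) :
  0 <= opnorm A.
Proof.
have := @l2norm_le_opnorm R m n A 0.
by rewrite mulmx0 /l2norm -!/(sqnorm _) !sqnorm0 sqrtr0; apply.
Qed.

(** By homogeneity: [opnorm] only sees the unit ball, so a nonzero [x] is first scaled to norm 1. *)
Lemma sqnorm_le_opnorm {R : realType} {m n : nat} (A : 'M[R]_(m, n))
    (x : 'cV[R]_n) :
  sqnorm (A *m x) <= opnorm A ^+ 2 * sqnorm x.
Proof.
have [/sqnorm_eq0 ->|x_neq0] := eqVneq (sqnorm x) 0.
  by rewrite mulmx0 !sqnorm0 mulr0.
have x_gt0 : 0 < sqnorm x by rewrite lt_def x_neq0 sqnorm_ge0.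
pose y := (l2norm x)^-1 *: x.
have sqy : sqnorm y = 1 by rewrite sqnormZ exprVn sqr_l2norm mulVf.
have : l2norm (A *m y) ^+ 2 <= opnorm A ^+ 2.
  rewrite lerXn2r ?nnegrE ?sqrtr_ge0 ?opnorm_ge0 // l2norm_le_opnorm //.
  by rewrite /l2norm -/(sqnorm y) sqy sqrtr1.
rewrite sqr_l2norm -scalemxAr sqnormZ exprVn sqr_l2norm mulrC.
by rewrite ler_pdivrMr.
Qed.

(** If the norm vanished, each column of [A], being the image of a basis vector, would be zero. *)
Lemma opnorm_gt0 {R : realType} {m n : nat} (A : 'M[R]_(m, n)) :
  A != 0 -> 0 < opnorm A.
Proof.
move=> A_neq0; rewrite lt_def opnorm_ge0 andbT; apply: contra A_neq0 => /eqP A0.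
apply/eqP/matrixP => i b; rewrite mxE.
suff /colP/(_ i) : col b A = 0 by rewrite !mxE.
rewrite colE; apply: sqnorm_eq0.
apply/eqP; rewrite eq_le sqnorm_ge0 andbT.
by apply: le_trans (sqnorm_le_opnorm A _) _; rewrite A0 expr0n mul0r.
Qed.

Lemma opnorm_castmx {R : realType} {m n n' : nat} (e : n = n')
    (A : 'M[R]_(m, n)) :
  opnorm (castmx (erefl m, e) A) = opnorm A.
Proof. by case: n' / e; rewrite castmx_id. Qed.

(* Otherwise [M := s - A^T A], with [s := opnorm A ^+ 2], is invertible; as
   [0 <= M <= s], positivity at [x - s^-1 M x] gives
   [s^-1 |M x|^2 <= x^T M x = s |x|^2 - |A x|^2], and [|x|^2 <= C |M x|^2] makes
   the bound [|A x|^2 <= s |x|^2] improvable. *)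
Lemma eigenvalue_opnorm {R : realType} {m n : nat} (A : 'M[R]_(m, n)) :
  A != 0 -> eigenvalue (A^T *m A) (opnorm A ^+ 2).
Proof.
move=> /opnorm_gt0 a_gt0; set s := opnorm A ^+ 2.
have s_gt0 : 0 < s by rewrite exprn_gt0.
rewrite /eigenvalue /eigenspace kermx_eq0 row_free_unit.
(* [N] is the matrix [- M], kept opaque; the test vector [x - s^-1 M x] becomes [x + s^-1 *: y]. *)
have [N defN] : exists N, N = A^T *m A - s%:M by exists (A^T *m A - s%:M).
rewrite -defN; apply/negP => unitN.
have [C C_gt0 leC] := sqnorm_mulmx_bounded (invmx N).
have addE (P Q : 'M[R]_1) : (P + Q) 0 0 = P 0 0 + Q 0 0 by rewrite mxE.
have scaleE d (P : 'M[R]_1) : (d *: P) 0 0 = d * P 0 0 by rewrite mxE.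
have improve x : sqnorm (A *m x) <= (s - (s * C)^-1) * sqnorm x.
  set y := N *m x.
  have leCx : sqnorm x <= C * sqnorm y.
    by rewrite -{1}[x](mulKmx unitN) leC.
  have NT : N^T = N by rewrite defN linearB /= trmx_mul trmxK tr_scalar_mx.
  have sqA (z : 'cV[R]_n) :
      sqnorm (A *m z) = (z^T *m (N *m z)) 0 0 + s * sqnorm z.
    rewrite sqnorm_mulmx -[A^T *m A](subrK s%:M) -defN mulmxDl mulmxDr addE.
    by rewrite mul_scalar_mx -scalemxAr scaleE -sqnormE.
  have leA := sqnorm_le_opnorm A (x + s^-1 *: y).
  have yNx : (y^T *m (N *m x)) 0 0 = sqnorm y by rewrite sqnormE.
  have xNy : (x^T *m (N *m y)) 0 0 = sqnorm y.
    by rewrite sqnormE trmx_mul NT !mulmxA.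
  (* This is [0 <= |A y|^2], rewritten through [sqA]. *)
  have yNy : - s * sqnorm y <= (y^T *m (N *m y)) 0 0.
    by rewrite mulNr lerNl -subr_ge0 opprK addrC -sqA sqnorm_ge0.
  (* For [z = x + s^-1 *: y], [leA] says [z^T N z <= 0]. The two cross terms add [2 s^-1 |y|^2], and
     by [yNy] the quadratic term in [y] takes back at most [s^-1 |y|^2]. *)
  have : (x^T *m (N *m x)) 0 0 + s^-1 * sqnorm y <= 0.
    move: leA; rewrite sqA -lerBrDr -/s subrr.
    rewrite linearD linearZ /= !mulmxDr !mulmxDl -!scalemxAr -!scalemxAl.
    rewrite !(addE, scaleE). rewrite yNx xNy; apply: le_trans.
    have := ler_wpM2l (sqr_ge0 s^-1) yNy.
    have -> : s^-1 ^+ 2 * (- s * sqnorm y) = - (s^-1 * sqnorm y).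
      by field; rewrite gt_eqF.
    lra.
  rewrite sqA.
  have : (s * C)^-1 * sqnorm x <= s^-1 * sqnorm y.
    rewrite invfM -mulrA ler_wpM2l ?invr_ge0 ?(ltW s_gt0) //.
    by rewrite mulrC ler_pdivrMr // mulrC.
  lra.
set t := s - _ in improve.
have t_lt : t < s by rewrite ltrBlDr ltrDl invr_gt0 mulr_gt0.
(* The sign of [t] is not known, and only a nonnegative number is the square of its [Num.sqrt]; [u]
   is still below [s]. *)
set u := Num.max t 0.
have u_ge0 : 0 <= u by rewrite le_max lexx orbT.
have : opnorm A <= Num.sqrt u.
  apply: opnorm_le => [|x]; first exact: sqrtr_ge0.
  rewrite sqr_sqrtr //; apply: le_trans (improve x) _.
  by rewrite ler_wpM2r ?sqnorm_ge0 // le_max lexx.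
rewrite -ler_sqr ?nnegrE ?sqrtr_ge0 ?opnorm_ge0 // sqr_sqrtr // -/s.
by rewrite leNgt gt_max t_lt s_gt0.
Qed.

(** An eigenvector satisfies [|A v|^2 = a |v|^2]. Eigenvectors are row vectors here, hence the
    transposes. *)
Lemma eigenvalue_le_opnorm {R : realType} {m n : nat} (A : 'M[R]_(m, n))
    (a : R) :
  eigenvalue (A^T *m A) a -> a <= opnorm A ^+ 2.
Proof.
move=> /eigenvalueP[v vA v_neq0].
have v_gt0 : 0 < sqnorm v^T.
  rewrite lt_def sqnorm_ge0 andbT; apply: contra v_neq0 => /eqP/sqnorm_eq0 v0.
  by rewrite -[v]trmxK v0 trmx0.
rewrite -(ler_pM2r v_gt0); apply: le_trans (sqnorm_le_opnorm A v^T).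
rewrite sqnorm_mulmx trmxK mulmxA vA -scalemxAl mxE.
by rewrite [sqnorm v^T]sqnormE trmxK.
Qed.

(** * Entries of the list of singular values *)

Lemma mem_rootsR {R : rcfType} (p : {poly R}) (x : R) :
  p != 0 -> (x \in rootsR p) = root p x.
Proof. by move=> p_neq0; rewrite -roots_on_rootsR. Qed.

Lemma mem_singular_values {R : realType} {m n : nat} (A : 'M[R]_(m, n))
    (y : R) :
  reflect (exists2 x, eigenvalue (A^T *m A) x & y = Num.sqrt x)
          (y \in singular_values A).
Proof.
rewrite mem_sort; set p := char_poly _.
have p_neq0 : p != 0 by rewrite monic_neq0 // char_poly_monic.
apply: (iffP flattenP) => [[_ /mapP[x px ->]]|[x]].
  rewrite mem_nseq => /andP[_ /eqP ->]; exists x => //.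
  by rewrite eigenvalue_root_char -mem_rootsR.
rewrite eigenvalue_root_char => px ->.
exists (nseq (mup x p) (Num.sqrt x)).
  by apply/mapP; exists x; rewrite // mem_rootsR.
(* A root has positive multiplicity, so its [nseq] is not empty. *)
by rewrite mem_nseq eqxx -XsubC_dvd // dvdp_XsubCl px.
Qed.

(** The operator norm belongs to the list and bounds all its entries, so it is the head of this
    nonincreasing list. *)
Lemma singular_value1 {R : realType} {m n : nat} (A : 'M[R]_(m, n)) :
  A != 0 -> singular_value A 1 = opnorm A.
Proof.
move=> A_neq0; rewrite /singular_value /=.
have le_op y : y \in singular_values A -> y <= opnorm A.
  case/mem_singular_values => x Ax ->.
  rewrite -[leRHS]ger0_norm ?opnorm_ge0 // -sqrtr_sqr ler_wsqrtr //.
  exact: eigenvalue_le_opnorm.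
have op_in : opnorm A \in singular_values A.
  apply/mem_singular_values; exists (opnorm A ^+ 2).
    exact: eigenvalue_opnorm.
  by rewrite sqrtr_sqr ger0_norm // opnorm_ge0.
have : sorted >=%R (singular_values A).
  by apply: sort_sorted => x y; apply: le_total.
case: (singular_values A) le_op op_in => // y ys le_op op_in /=.
rewrite path_sortedE; last by move=> b a d ab bd; apply: le_trans bd ab.
case/andP=> /allP y_max _; apply/eqP.
rewrite eq_le le_op ?mem_head //=.
by move: op_in; rewrite inE => /predU1P[-> //|/y_max].
Qed.

(** * Singular values from a diagonalization *)

(** [X - P D Q = P (X - D) Q], because the scalar matrix [X] commutes with [P]; the determinants of
    [P] and [Q] then cancel. *)
Lemma char_poly_conj {R : comUnitRingType} {n : nat} (P Q D : 'M[R]_n) :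
  Q *m P = 1%:M -> char_poly (P *m D *m Q) = char_poly D.
Proof.
move=> QP; have PQ : P *m Q = 1%:M by apply: mulmx1C.
rewrite /char_poly; have -> : char_poly_mx (P *m D *m Q) =
    map_mx polyC P *m char_poly_mx D *m map_mx polyC Q.
  rewrite /char_poly_mx mulmxBr mulmxBl !map_mxM; congr (_ - _).
  by rewrite scalar_mxC -mulmxA -map_mxM PQ map_mx1 mulmx1.
by rewrite !det_mulmx mulrAC -det_mulmx -map_mxM PQ map_mx1 det1 mul1r.
Qed.

Lemma mup_prod_XsubC {F : fieldType} (x : F) (s : seq F) :
  mup x (\prod_(y <- s) ('X - y%:P)) = count_mem x s.
Proof.
elim: s => [|y s IHs]; first by rewrite big_nil mupNroot // root1.
rewrite big_cons mupM ?polyXsubC_eq0 ?monic_neq0 ?monicXsubC //.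
  by rewrite IHs -['X - _]expr1 mup_XsubCX /=; case: eqVneq.
by rewrite monic_prod_XsubC.
Qed.

Lemma perm_roots_mup {R : rcfType} (s : seq R) (p : {poly R}) :
  p = \prod_(y <- s) ('X - y%:P) ->
  perm_eq (flatten [seq nseq (mup x p) x | x <- rootsR p]) s.
Proof.
move=> defp.
have p_neq0 : p != 0 by rewrite defp monic_neq0 // monic_prod_XsubC.
apply: perm_trans (perm_count_undup s).
under eq_map do rewrite defp mup_prod_XsubC -defp.
apply/perm_flatten/perm_map/uniq_perm; rewrite ?undup_uniq ?uniq_roots //.
by move=> x; rewrite mem_rootsR // mem_undup defp root_prod_XsubC.
Qed.

(** Conjugation by [V] preserves the characteristic polynomial, so both lists have the same entries
    with multiplicity. Both are nonincreasing, hence they are equal. *)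
Lemma singular_values_diag {R : realType} {m n : nat} (A : 'M[R]_(m, n))
    (V D : 'M[R]_n) :
  orthogonal_mx V -> is_diag_mx D -> A^T *m A = V^T *m D *m V ->
  (forall b b' : 'I_n, (b <= b')%N -> D b' b' <= D b b) ->
  singular_values A = [seq Num.sqrt (D b b) | b <- enum 'I_n].
Proof.
move=> [_ VVt] diagD defA decrD; rewrite /singular_values defA.
rewrite char_poly_conj // (char_poly_trig (is_diag_mx_is_trig diagD)).
set p := \prod_(_ < _) _.
have /perm_roots_mup :
    p = \prod_(y <- [seq D b b | b <- enum 'I_n]) ('X - y%:P).
  by rewrite big_map big_enum.
move=> /(perm_map Num.sqrt); rewrite map_flatten -map_comp.
rewrite (eq_map (g := fun x => nseq (mup x p) (Num.sqrt x))); last first.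
  by move=> x /=; rewrite map_nseq.
move=> perm_p; apply: (@sorted_eq _ >=%R).
- by move=> b a d ab bd; apply: le_trans bd ab.
- by move=> a b; rewrite andbC; apply: le_anti.
- by apply: sort_sorted => x y; apply: le_total.
- apply: (homo_sorted (e := fun b b' : 'I_n => (b <= b')%N)).
    by move=> b b' bb' /=; apply/ler_wsqrtr/decrD.
  by have := iota_sorted 0 n; rewrite -val_enum_ord sorted_map.
- by rewrite perm_sort (map_comp Num.sqrt (fun b => D b b)).
Qed.

Lemma gram_diag {R : nzRingType} {m n : nat} (S : 'M[R]_(m, n)) :
  is_diag_mx S -> is_diag_mx (S^T *m S).
Proof.
move=> /is_diag_mxP S0; apply/is_diag_mxP => b b' bb'.
rewrite mxE big1 // => a _; rewrite mxE.
have [ab|/S0 ->] := eqVneq (a : nat) b; last by rewrite mul0r.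
by rewrite (S0 a b') ?mulr0 // ab.
Qed.

Lemma gram_diagE {R : nzRingType} {m n : nat} (S : 'M[R]_(m, n))
    (a : 'I_m) (b : 'I_n) :
  is_diag_mx S -> a = b :> nat -> (S^T *m S) b b = S a b ^+ 2.
Proof.
move=> /is_diag_mxP S0 ab; rewrite mxE (bigD1 a) //= big1 => [|a' aa'].
  by rewrite addr0 mxE expr2.
by rewrite (S0 a' b) ?mulr0 // -ab.
Qed.

Lemma sqnorm_diag_le {R : realType} {m n : nat} (S : 'M[R]_(m, n)) (c : R)
    (x : 'cV[R]_n) :
  0 <= c -> is_diag_mx S ->
  (forall (a : 'I_m) (b : 'I_n), a = b :> nat -> S a b ^+ 2 <= c) ->
  sqnorm (S *m x) <= c * sqnorm x.
Proof.
move=> c_ge0 diagS leSc; rewrite sqnorm_mulmx mxE mulr_sumr.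
apply: ler_sum => b _; rewrite mxE [X in _ * X]mxE (bigD1 b) //= big1.
  rewrite addr0 mulrCA -expr2 ler_wpM2r ?sqr_ge0 //.
  (* When [m <= b], column [b] of [S] has no diagonal entry and is zero. *)
  have [bm|mb] := ltnP b m.
    by rewrite (gram_diagE S (Ordinal bm) b) // leSc.
  rewrite mxE big1 // => a _; have /is_diag_mxP -> := diagS; rewrite ?mulr0 //.
  by rewrite ltn_eqF // (leq_trans (ltn_ord a)).
move=> b' bb'; have /is_diag_mxP -> := gram_diag S diagS; rewrite ?mul0r //.
by rewrite eq_sym.
Qed.

Lemma singular_value_ge0 {R : realType} {m n : nat} (A : 'M[R]_(m, n)) p :
  0 <= singular_value A p.
Proof.
rewrite /singular_value; set s := singular_values A.
have [lt_p|le_p] := ltnP p.-1 (size s); last by rewrite nth_default.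
by have /mem_singular_values[x _ ->] := mem_nth 0 lt_p; apply: sqrtr_ge0.
Qed.

(** [U] cancels in [A^T A = V^T (S^T S) V]. The diagonal of [S^T S] has length [n] whatever [m] is,
    and so includes the padding zeros when [m < n]. *)
Lemma singular_values_svd {R : realType} {m n : nat} (A : 'M[R]_(m, n)) U S V :
  is_svd A U S V ->
  singular_values A = [seq Num.sqrt ((S^T *m S) b b) | b <- enum 'I_n].
Proof.
case=> -[UtU _] orthV [diagS ->] S_ge0 S_decr.
apply: (singular_values_diag _ V _ orthV (gram_diag S diagS)) => [|b b' bb'].
  by rewrite !trmx_mul !mulmxA -(mulmxA (V^T *m S^T)) UtU mulmx1.
have [b'm|mb'] := ltnP b' m.
  have bm := leq_ltn_trans bb' b'm.
  rewrite (gram_diagE S (Ordinal bm) b) // (gram_diagE S (Ordinal b'm) b') //.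
  by rewrite lerXn2r ?nnegrE ?S_ge0 // S_decr.
rewrite [leLHS]mxE big1 => [|a _].
  by rewrite mxE sumr_ge0 // => a _; rewrite mxE -expr2 sqr_ge0.
have /is_diag_mxP -> := diagS; rewrite ?mulr0 //.
by rewrite ltn_eqF // (leq_trans (ltn_ord a)).
Qed.

(** * Truncation error and its assembly over the blocks *)

(** The error is [U E V] with [E] diagonal: zero in its first [j] positions, minus the entries of
    [S] afterwards. The orthogonal factors preserve norms, and the largest remaining entry is the
    [(j+1)]-st. *)
Lemma sqnorm_rank_approx {R : realType} {j m n : nat} (A A_hat : 'M[R]_(m, n))
    (x : 'cV[R]_n) :
  is_rank_approx j A A_hat ->
  sqnorm ((A_hat - A) *m x) <= singular_value A j.+1 ^+ 2 * sqnorm x.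
Proof.
move=> [U [S [V [svdA ->]]]]; have svA := singular_values_svd A U S V svdA.
case: svdA => orthU orthV [diagS ->] S_ge0 S_decr in svA *.
have /is_diag_mxP S0 := diagS.
set c := singular_value _ _.
set E := diag_truncate j S - S.
have -> : U *m diag_truncate j S *m V - U *m S *m V = U *m (E *m V).
  by rewrite -mulmxBl -mulmxBr mulmxA.
rewrite -!mulmxA sqnorm_orthogonal // -(sqnorm_orthogonal V x orthV).
apply: sqnorm_diag_le; first exact: sqr_ge0.
  by apply/is_diag_mxP => a b ab; rewrite !mxE (negPf ab) S0 // subr0.
move=> a b ab; rewrite !mxE ab eqxx /=.
have [|le_jb] := ltnP b j; first by rewrite subrr expr0n sqr_ge0.
have lt_jn := leq_ltn_trans le_jb (ltn_ord b).
have lt_jm : (j < m)%N by rewrite (leq_ltn_trans le_jb) // -ab.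
(* Counting from 0, the [(j+1)]-st diagonal position is [j]. It exists because [b] lies at or beyond
   it, so the lookup does not fall back on the default [0]. *)
pose aj := Ordinal lt_jm; pose bj := Ordinal lt_jn.
rewrite /c /singular_value svA /= (nth_map bj) ?size_enum_ord //.
rewrite -[j]/(val bj) nth_ord_enum (gram_diagE S aj bj) //.
rewrite sqr_sqrtr ?sqr_ge0 // sub0r sqrrN.
by rewrite lerXn2r ?nnegrE ?S_ge0 // S_decr // ab.
Qed.

Lemma sqnorm_mxcol {R : realType} {k : nat} {n : 'I_k -> nat}
    (x : forall i, 'cV[R]_(n i)) :
  sqnorm (\mxcol_i x i) = \sum_i sqnorm (x i).
Proof.
rewrite sqnormE tr_mxcol mul_mxrow_mxcol summxE.
by apply: eq_bigr => i _; rewrite sqnormE.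
Qed.

Lemma opnorm_mxrow_le {R : realType} {m k : nat} {n : 'I_k -> nat}
    (E : forall i, 'M[R]_(m, n i)) (c : R) :
  0 <= c -> (forall i x, sqnorm (E i *m x) <= c ^+ 2 * sqnorm x) ->
  opnorm (\mxrow_i E i) <= Num.sqrt k%:R * c.
Proof.
move=> c_ge0 leEc; apply: opnorm_le => [|x].
  by rewrite mulr_ge0 ?sqrtr_ge0.
rewrite exprMn sqr_sqrtr // -[x]submxcolK mul_mxrow_mxcol sqnorm_mxcol.
apply: le_trans (sqnorm_sum_le _) _; rewrite -mulrA ler_wpM2l // mulr_sumr.
by apply: ler_sum => i _; apply: leEc.
Qed.

Lemma channel_concatB {R : realType} {f c kappa1 kappa2 k : nat}
    {cs : 'I_k -> nat} (sum_cs : (\sum_(i < k) cs i)%N = c)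
    (Ws : forall i : 'I_k, 'M[R]_(f, cs i * kappa1 * kappa2))
    (W : 'M[R]_(f, c * kappa1 * kappa2)) :
  channel_concat sum_cs Ws - W =
  castmx (erefl f, slicing_width kappa1 kappa2 sum_cs)
    (\mxrow_i (Ws i - channel_block sum_cs W i)).
Proof.
rewrite mxrowB [in RHS]/channel_block submxrowK /channel_concat.
(* Once the two widths are identified, both casts are identities. *)
case: _ / (slicing_width _ _ _) W => W.
by rewrite !castmx_id.
Qed.

Theorem theorem1 (R : realType) (f c kappa1 kappa2 k j : nat)
  (f_gt0 : (0 < f)%N) (c_gt0 : (0 < c)%N)
  (kappa1_gt0 : (0 < kappa1)%N) (kappa2_gt0 : (0 < kappa2)%N)
  (k_gt0 : (0 < k)%N) (j_gt0 : (0 < j)%N)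
  (cs : 'I_k -> nat)
  (sum_cs : (\sum_(i < k) cs i)%N = c)
  (cs_le : forall i : 'I_k, (cs i)%:Z <= Num.ceil (c%:R / k%:R : R))
  (W : 'M[R]_(f, c * kappa1 * kappa2)) (W_neq0 : W != 0)
  (W_hat : forall i : 'I_k, 'M[R]_(f, cs i * kappa1 * kappa2))
  (W_hatP : forall i : 'I_k,
     is_rank_approx j (channel_block sum_cs W i) (W_hat i)) :
  singular_value W 1 = opnorm W /\
  opnorm (channel_concat sum_cs W_hat - W) / opnorm W <=
    Num.sqrt k%:R / singular_value W 1 *
    \big[Num.max/0]_(i < k) singular_value (channel_block sum_cs W i) j.+1.
Proof.
rewrite singular_value1 //; split=> //.
set M := \big[Num.max/0]_(i < k) _.
(* The base value [0] of the maximum gives this; [M] can then be the common bound on the blocks in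
   [opnorm_mxrow_le]. *)
have M_ge0 : 0 <= M by apply: bigmax_ge_id.
rewrite mulrAC ler_wpM2r ?invr_ge0 ?opnorm_ge0 //.
rewrite channel_concatB opnorm_castmx; apply: opnorm_mxrow_le => // i x.
apply: le_trans (sqnorm_rank_approx _ _ x (W_hatP i)) _.
rewrite ler_wpM2r ?sqnorm_ge0 // lerXn2r ?nnegrE ?singular_value_ge0 //.
exact: le_bigmax.
Qed.
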